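(* If $K$ is a countable linear order that is not a well-order, then there is a countable ordinal $\alpha$ such that $\mathbb{Z}^K \simeq \mathbb{Z}^\alpha \mathbb{Q}$. Hence $\mathbb{Z}^K \equiv_s \mathbb{Q}$.
   Context: All linear orders are assumed non-empty (except that exponent $\alpha=0$ is allowed, with $\mathbb{Z}^0=1$ the one-point order). $\simeq$ denotes isomorphism of linear orders. $L\leq_s M$ means that there is an epimorphism (order preserving surjection) from $M$ onto $L$, and $L\equiv_s M$ means $L\leq_s M$ and $M\leq_s L$. For linear orders $L, K$, the product $LK$ is $\sum_{k\in K}L$, i.e. $K$ copies of $L$. For a linear order $K$ and $\varphi:K\to\mathbb{Z}$ let $\mathrm{Supp}(\varphi)=\{k\in K\mid\varphi(k)\neq 0\}$. $\mathbb{Z}^K$ is the set $\{\varphi:K\to\mathbb{Z}\mid \mathrm{Supp}(\varphi)\text{ is finite}\}$ ordered by: $\varphi\leq_{\mathbb{Z}^K}\psi$ iff $\varphi=\psi$ or $\varphi(k_0)<_{\mathbb{Z}}\psi(k_0)$ where $k_0=\max\{k\in\mathrm{Supp}(\varphi)\cup\mathrm{Supp}(\psi)\mid\varphi(k)\neq\psi(k)\}$. $\mathbb{Z}^\alpha$ for an ordinal $\alpha$ is this power with $K=\alpha$. *)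

(* Defs.v *)
From HB Require Import structures.
From mathcomp Require Import all_boot all_order all_algebra.
From mathcomp Require Import finmap.
From mathcomp Require Import boolp classical_sets cardinality wochoice.

Set Implicit Arguments.
Unset Strict Implicit.
Unset Printing Implicit Defensive.

Import Order.TTheory.
Local Open Scope order_scope.

(* Z^K.  The fresh name keeps the order below off the generic type of finitely
   supported functions. *)
Definition zpow d (K : orderType d) : Type := {fsfun K -> int with 0%R}.

Fact zpow_display (d : Order.disp_t) : Order.disp_t.
Proof. exact: d. Qed.

Section ZPow.
Context d (K : orderType d).
Implicit Types (f g h : zpow K) (k : K).

Definition zpow_fun f : K -> int := @fun_of_fsfun _ _ _ f.
Coercion zpow_fun : zpow >-> Funclass.

Definition zpow_supp f : {fset K} := @finsupp _ _ _ f.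

HB.instance Definition _ := Choice.copy (zpow K) {fsfun K -> int with 0%R}.

Definition zpow_diff f g : {fset K} :=
  [fset k in (zpow_supp f `|` zpow_supp g)%fset | f k != g k]%fset.

(* f k0 < g k0 at the maximum k0 of zpow_diff f g. *)
Definition zpow_lt f g : bool :=
  has (fun k0 => all (fun k => k <= k0) (zpow_diff f g) && (f k0 < g k0))
      (zpow_diff f g).

Definition zpow_le f g : bool := (f == g) || zpow_lt f g.

Lemma zpow_eqP f g : f =1 g <-> f = g.
Proof. exact: fsfunP. Qed.

Lemma in_zpow_supp f k : (k \in zpow_supp f) = (f k != 0%R).
Proof. exact: mem_finsupp. Qed.

Lemma in_zpow_diff f g k : (k \in zpow_diff f g) = (f k != g k).
Proof.
rewrite !inE /= !in_zpow_supp; case: (eqVneq (f k) 0%R) => [->|] //=.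
by rewrite eq_sym andbb.
Qed.

Lemma zpow_ltP f g :
  reflect (exists2 k0, f k0 < g k0 & forall k, k0 < k -> f k = g k)
          (zpow_lt f g).
Proof.
apply: (iffP hasP) => [[k0 _ /andP[/allP mx lt0]]|[k0 lt0 eqk]].
  exists k0 => // k ltk; apply/eqP; apply: contraTT ltk => neqk.
  by rewrite -leNgt; apply: mx; rewrite in_zpow_diff.
exists k0; first by rewrite in_zpow_diff lt_eqF.
rewrite lt0 andbT; apply/allP => k; rewrite in_zpow_diff => neqk.
by rewrite leNgt; apply: contra neqk => /eqk ->.
Qed.

Lemma zpow_lt_irr : irreflexive zpow_lt.
Proof. by move=> f; apply/zpow_ltP => -[k]; rewrite ltxx. Qed.

Lemma zpow_lt_trans : transitive zpow_lt.
Proof.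
move=> g f h /zpow_ltP[k ltk eqk] /zpow_ltP[l ltl eql]; apply/zpow_ltP.
case: (ltgtP k l) => [kl|lk|kl].
- exists l => [|m lm]; first by rewrite eqk.
  by rewrite eqk ?eql // (lt_trans kl).
- exists k => [|m km]; first by rewrite -eql.
  by rewrite eqk ?eql // (lt_trans lk).
- exists k => [|m km]; first by rewrite (lt_trans ltk) // kl.
  by rewrite eqk ?eql // -kl.
Qed.

Lemma seq_has_max (s : seq K) :
  s != [::] -> exists2 k0, k0 \in s & all (fun k => k <= k0) s.
Proof.
elim: s => // a s IHs _; have [->|/IHs[k ks /allP mx]] := eqVneq s [::].
  by exists a; rewrite ?inE //= lexx.
have [ak|/ltW ka] := leP a k.
  by exists k; rewrite ?inE ?ks ?orbT //= ak; apply/allP.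
exists a; rewrite ?inE ?eqxx //= lexx; apply/allP => x /mx xk.
exact: le_trans xk ka.
Qed.

Lemma zpow_lt_total f g : f != g -> zpow_lt f g || zpow_lt g f.
Proof.
move=> neqfg; have : zpow_diff f g != [::] :> seq K.
  apply: contra neqfg => /eqP D0; apply/eqP/zpow_eqP => k; apply/eqP.
  by apply: contraT; rewrite -in_zpow_diff -topredE /= /pred_of_finset D0.
case/seq_has_max => k0; rewrite in_zpow_diff => neq0 /allP mx.
have eqk k : k0 < k -> f k = g k.
  move=> ltk; apply/eqP; apply: contraTT ltk => neqk.
  by rewrite -leNgt; apply: mx; rewrite in_zpow_diff.
have [lt0|lt0|/eqP] := ltgtP (f k0) (g k0); last by rewrite (negbTE neq0).
- by apply/orP; left; apply/zpow_ltP; exists k0.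
- by apply/orP; right; apply/zpow_ltP; exists k0 => // k /eqk.
Qed.

HB.instance Definition _ := Order.LtOrder.Build (zpow_display d) (zpow K)
  (fun _ _ => erefl) (fun _ _ => erefl) (fun _ _ => erefl)
  zpow_lt_irr zpow_lt_trans zpow_lt_total.

End ZPow.

(* The product of L and K is K copies of L, so K is the dominant coordinate;
   in T *l T' the first coordinate is the dominant one. *)
Notation order_prod L K := (K *l L)%type.

Definition order_iso d d' (L : orderType d) (M : orderType d') : Prop :=
  exists2 f : L -> M, bijective f & {mono f : x y / x <= y}.

(* L <=_s M: the epimorphism goes from M onto L. *)
Definition epi_le d d' (L : orderType d) (M : orderType d') : Prop :=
  exists f : {omorphism M -> L}, forall y : L, exists x : M, f x = y.

Definition epi_equiv d d' (L : orderType d) (M : orderType d') : Prop :=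
  epi_le L M /\ epi_le M L.

(* Main.v *)
(* Let A be the well-ordered part of K, i.e. the largest well-ordered initial
   segment, and B its complement.  As K is not a well-order, B is nonempty, and
   by maximality of A it has no minimum.  Restriction to A and B gives
   Z^K = Z^(A+B) = Z^A Z^B.  As B has no minimum, Z^B is a countable dense
   order without endpoints, so it is isomorphic to Q by Cantor's theorem.
   Projecting Z^A Q onto Q gives one epimorphism; the other is the projection
   onto Z^K of the order obtained by replacing each point of Z^K by a copy of
   Q, which is isomorphic to Q. *)
Require Import Defs.
From HB Require Import structures.
From mathcomp Require Import all_boot all_order all_algebra.
From mathcomp Require Import finmap.
From mathcomp Require Import boolp classical_sets cardinality wochoice.

Import Order.TTheory.
Local Open Scope order_scope.

(** * Countability, isomorphisms and epimorphisms of linear orders *)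

Lemma countable_inj {T U : Type} {f : T -> U} :
  injective f -> countable [set: U]%classic -> countable [set: T]%classic.
Proof.
move=> f_inj /countable_injP[g g_inj]; apply/countable_injP.
exists (g \o f) => x y _ _ /= eq_gf; apply: f_inj.
by apply: g_inj eq_gf; rewrite in_setT.
Qed.

Lemma countable_prod {T U : Type} :
  countable [set: T]%classic -> countable [set: U]%classic ->
  countable [set: T * U]%classic.
Proof. by move=> cT cU; rewrite -setXTT; apply: countableX. Qed.

Lemma strict_mono_surj_order_iso {d d'} {L : orderType d} {M : orderType d'}
    (f : L -> M) :
  {homo f : x y / x < y} -> (forall y, exists x, f x = y) -> order_iso L M.
Proof.
move=> /le_mono f_mono /choice[g fK]; exists f => //.
exists g => // x; apply: (inc_inj f_mono); exact: fK.
Qed.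

Lemma epi_leI {d d'} {L : orderType d} {M : orderType d'} (f : M -> L) :
  {homo f : x y / x <= y} -> (forall y, exists x, f x = y) -> epi_le L M.
Proof.
move=> f_homo f_surj.
by exists (HB.pack_for {omorphism M -> L} f
  (Order.isOrderMorphism.Build _ _ _ _ f f_homo)).
Qed.

Lemma lexi_ltE {d d'} {T : orderType d} {U : orderType d'} (x y : T *l U) :
  (x < y) = (x.1 < y.1) || (x.1 == y.1) && (x.2 < y.2).
Proof. by rewrite ltEprodlexi; case: (ltgtP x.1 y.1). Qed.

(** * Dense orders without endpoints and Cantor's theorem *)

Definition unbounded_dense {d} (T : orderType d) : Prop :=
  [/\ inhabited T,
      forall x : T, exists y, y < x,
      forall x : T, exists y, x < y
    & forall x y : T, x < y -> exists z, x < z < y].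

Lemma unbounded_dense_rat : unbounded_dense rat.
Proof.
split=> [|x|x|x y xy]; first by constructor; exact: 0%R.
- by exists (x - 1)%R; rewrite Num.Theory.ltrBlDr Num.Theory.ltrDl.
- by exists (x + 1)%R; rewrite Num.Theory.ltrDl.
- by exists ((x + y) / 2%:R)%R; rewrite !Num.Theory.midf_lt.
Qed.

(** Every point sought is found by moving the minor coordinate: if the dominant coordinates differ,
    a step up from the smaller point inside its copy of [U] already lands in between. *)
Lemma unbounded_dense_lexi {d d'} {T : orderType d} {U : orderType d'} :
  inhabited T -> unbounded_dense U -> unbounded_dense (T *l U).
Proof.
move=> [t] [[u] U_lt U_gt U_dense]; split=> [|[a b]|[a b]|[a b] [a' b']].
- by constructor; exact: (t, u).
- have [c cb] := U_lt b; exists (a, c).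
  by rewrite lexi_ltE /= eqxx cb orbT.
- have [c cb] := U_gt b; exists (a, c).
  by rewrite lexi_ltE /= eqxx cb orbT.
rewrite lexi_ltE /= => /orP[aa'|/andP[/eqP <- /U_dense[c /andP[bc cb']]]].
  have [c bc] := U_gt b; exists (a, c).
  by rewrite !lexi_ltE /= eqxx bc aa' orbT.
by exists (a, c); rewrite !lexi_ltE /= eqxx bc cb' orbT.
Qed.

(** Only the maximum of [s] and the minimum of [t], a maximum in the dual order [T^d], matter. The
    four cases of emptiness use one clause of [unbounded_dense] each. *)
Lemma dense_separation {d} {T : orderType d} (s t : seq T) :
  unbounded_dense T -> {in s & t, forall x y, x < y} ->
  exists z, {in s, forall x, x < z} /\ {in t, forall y, z < y}.
Proof.
move=> [[a] T_lt T_gt T_dense] st.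
have [->|/seq_has_max[m ms /allP le_m]] := eqVneq s [::];
  have [->|/(@seq_has_max _ T^d)[n nt /allP le_n]] := eqVneq t [::].
- by exists a.
- have [z zn] := T_lt n; exists z; split=> // y /le_n.
  exact: lt_le_trans zn.
- have [z mz] := T_gt m; exists z; split=> // x /le_m xm.
  exact: le_lt_trans mz.
- have [z /andP[mz zn]] := T_dense _ _ (st _ _ ms nt).
  exists z; split=> [x /le_m xm|y /le_n]; last exact: lt_le_trans zn.
  exact: le_lt_trans mz.
Qed.

(** By totality this also makes the list the graph of an injective partial function: first
    coordinates are equal exactly when the second ones are. *)
Definition partial_iso {d d'} {T : orderType d} {U : orderType d'}
    (p : seq (T * U)) : Prop :=
  {in p &, forall a b, (a.1 < b.1) = (a.2 < b.2)}.

Lemma partial_iso_forth {d d'} {T : orderType d} {U : orderType d'}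
    {p : seq (T * U)} (x : T) :
  unbounded_dense U -> partial_iso p -> exists y, partial_iso ((x, y) :: p).
Proof.
move=> U_dense p_iso.
have [[y xyp]|xNp] := pselect (exists y, (x, y) \in p).
  exists y => a b; rewrite !inE => /predU1P[->|ap] /predU1P[->|bp];
    exact: p_iso.
(* The image of [x] has to lie above the images of the points below [x] and below the images of the
   points above [x]. *)
pose s := [seq a.2 | a <- p & a.1 < x]; pose t := [seq a.2 | a <- p & x < a.1].
have [|y [ys yt]] := dense_separation s t U_dense.
  move=> _ _ /mapP[a + ->] /mapP[b + ->].
  rewrite !mem_filter => /andP[ax ap] /andP[xb bp].
  by rewrite -p_iso // (lt_trans ax).
have xy a : a \in p -> ((a.1 < x) = (a.2 < y)) * ((x < a.1) = (y < a.2)).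
  move=> ap; case: (ltgtP a.1 x) => [ax|xa|ax].
  - have ay : a.2 < y by apply/ys/map_f; rewrite mem_filter ax.
    by rewrite ay; split=> //; rewrite lt_gtF.
  - have ya : y < a.2 by apply/yt/map_f; rewrite mem_filter xa.
    by rewrite ya; split=> //; rewrite lt_gtF.
  - by case: xNp; exists a.2; rewrite -ax -surjective_pairing.
exists y => a b; rewrite !inE => /predU1P[->|ap] /predU1P[->|bp] /=.
- by rewrite !ltxx.
- by rewrite (xy b).
- by rewrite (xy a).
- exact: p_iso.
Qed.

Lemma partial_iso_back {d d'} {T : orderType d} {U : orderType d'}
    {p : seq (T * U)} (y : U) :
  unbounded_dense T -> partial_iso p -> exists x, partial_iso ((x, y) :: p).
Proof.
move=> T_dense p_iso; pose swap (a : T * U) := (a.2, a.1).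
have [|x q_iso] := @partial_iso_forth _ _ U T (map swap p) y T_dense.
  move=> _ _ /mapP[a ap ->] /mapP[b bp ->] /=.
  by rewrite p_iso.
exists x => a b ap bp.
exact/esym/(q_iso (swap a) (swap b) (map_f swap ap) (map_f swap bp)).
Qed.

Lemma partial_iso_back_and_forth {d d'} {T : orderType d} {U : orderType d'}
    {i : T -> nat} {j : U -> nat} {p : seq (T * U)} (n : nat) :
  unbounded_dense T -> unbounded_dense U -> injective i -> injective j ->
  partial_iso p ->
  exists q, [/\ partial_iso q, {subset p <= q},
    forall x, i x = n -> exists y, (x, y) \in q
  & forall y, j y = n -> exists x, (x, y) \in q].
Proof.
move=> T_dense U_dense i_inj j_inj p_iso.
have [q [q_iso pq qi]] : exists q, [/\ partial_iso q, {subset p <= q}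
    & forall x, i x = n -> exists y, (x, y) \in q].
  have [[x ix]|Ni] := pselect (exists x, i x = n); last first.
    by exists p; split=> // x ix; case: Ni; exists x.
  have [y q_iso] := partial_iso_forth x U_dense p_iso.
  exists ((x, y) :: p); split=> // [a ap|x' ix'].
    by rewrite inE ap orbT.
  by exists y; rewrite (i_inj x' x) ?mem_head // ix'.
have [[y jy]|Nj] := pselect (exists y, j y = n); last first.
  by exists q; split=> // y jy; case: Nj; exists y.
have [x r_iso] := partial_iso_back y T_dense q_iso.
exists ((x, y) :: q); split=> // [a ap|x' /qi[y' xy'q]|y' jy'].
- by rewrite inE pq ?orbT.
- by exists y'; rewrite inE xy'q orbT.
- by exists x; rewrite (j_inj y' y) ?mem_head // jy'.
Qed.

(** Back-and-forth: stage [n] adds the points of [T] and [U] coded by [n], and the union of the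
    increasing chain of finite partial isomorphisms is the graph of [f]. *)
Theorem cantor_order_iso {d d'} {T : orderType d} {U : orderType d'} :
  countable [set: T]%classic -> countable [set: U]%classic ->
  unbounded_dense T -> unbounded_dense U ->
  exists2 f : T -> U, {homo f : x y / x < y} & forall y, exists x, f x = y.
Proof.
move=> /countable_injP[i i_inj] /countable_injP[j j_inj] T_dense U_dense.
have {}i_inj : injective i by move=> x y; apply: i_inj; rewrite in_setT.
have {}j_inj : injective j by move=> x y; apply: j_inj; rewrite in_setT.
(* With [partial_iso p] as a premise inside [good], choice yields a total extension function [F];
   its value on other lists is arbitrary. *)
pose good p n (q : seq (T * U)) := partial_iso p ->
  [/\ partial_iso q, {subset p <= q},
    forall x, i x = n -> exists y, (x, y) \in q
  & forall y, j y = n -> exists x, (x, y) \in q].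
have /choice[F FP] (pn : seq (T * U) * nat) : exists q, good pn.1 pn.2 q.
  have [p_iso|Np] := pselect (partial_iso pn.1); last by exists [::].
  by have [q qP] := partial_iso_back_and_forth pn.2 T_dense U_dense
    i_inj j_inj p_iso; exists q.
pose fix s n := if n is m.+1 then F (s m, m) else [::].
have s_iso n : partial_iso (s n) by elim: n => // n /(FP (s n, n))[].
have sS n : good (s n) n (s n.+1) := FP (s n, n).
have s_sub m n : (m <= n)%N -> {subset s m <= s n}.
  elim: n => [|n IHn]; first by rewrite leqn0 => /eqP ->.
  rewrite leq_eqVlt => /predU1P[-> //|/IHn mn] a /mn.
  by have [_ + _ _] := sS n (s_iso n); apply.
have sR a b m n : a \in s m -> b \in s n -> (a.1 < b.1) = (a.2 < b.2).
  move=> /(s_sub _ _ (leq_maxl m n)) am /(s_sub _ _ (leq_maxr m n)) bn.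
  exact: s_iso am bn.
have /choice[f fP] x : exists y, exists n, (x, y) \in s n.
  have [_ _ + _] := sS (i x) (s_iso _).
  by move=> /(_ x erefl)[y xy]; exists y, (i x).+1.
exists f => [x y xy|y].
  by have [m xm] := fP x; have [n yn] := fP y; rewrite -(sR _ _ _ _ xm yn).
have [_ _ _ /(_ y erefl)[x xy]] := sS (j y) (s_iso _).
(* Both [(x, y)] and [(x, f x)] occur in the chain, so neither [y < f x] nor [f x < y] can hold. *)
exists x; have [n xn] := fP x.
have /= := sR _ _ _ _ xy xn; have /= := sR _ _ _ _ xn xy.
by rewrite !ltxx; case: ltgtP.
Qed.

(** * Construction, countability and density of finite-support powers *)

Section ZPowTheory.
Context {d : Order.disp_t} {K : orderType d}.
Implicit Types (f g h : zpow K) (k : K).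

Lemma zpow_ltE f g : (f < g) = zpow_lt f g.
Proof. by []. Qed.

Lemma zpow_of_fun (F : K -> int) (s : seq K) :
  (forall k, F k != 0%R -> k \in s) -> exists h, h =1 F.
Proof.
move=> Fs; exists ([fsfun k in seq_fset tt s => F k] : zpow K) => k.
rewrite /zpow_fun fsfunE seq_fsetE; case: ifPn => // kNs.
by apply/esym/eqP; apply: contraNT kNs => /Fs.
Qed.

Lemma zpow_inhabited : inhabited (zpow K).
Proof.
by have [k|h _] := @zpow_of_fun (fun=> 0%R) [::]; [rewrite eqxx|constructor].
Qed.

Lemma zpow_update f k (v : int) :
  exists h, h k = v /\ forall l, l != k -> h l = f l.
Proof.
have [l|h hE] :=
    @zpow_of_fun (fun l => if l == k then v else f l) (k :: zpow_supp f).
  by rewrite inE in_zpow_supp; case: (eqVneq l k).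
by exists h; rewrite !hE eqxx; split=> // l /negPf lk; rewrite hE lk.
Qed.

Lemma countable_zpow :
  countable [set: K]%classic -> countable [set: zpow K]%classic.
Proof.
move=> /countable_injP[i i_inj].
have {}i_inj : injective i by move=> x y; apply: i_inj; rewrite in_setT.
(* The values on the support, listed with codes of the coordinates, determine [f]; where [f]
   vanishes, agreement follows by exchanging [f] and [g]. *)
pose graph f := [seq (i k, f k) | k <- zpow_supp f].
apply: (@countable_inj _ _ graph); last exact: countableP.
have graph_val f g k : graph f = graph g -> f k != 0%R -> f k = g k.
  rewrite -in_zpow_supp => eq_fg /(map_f (fun l => (i l, f l))).
  by rewrite -/(graph f) eq_fg => /mapP[l _ [/i_inj <-]].
move=> f g eq_fg; apply/zpow_eqP => k.
have [fk0|] := eqVneq (f k) 0%R; last exact: graph_val.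
have [gk0|] := eqVneq (g k) 0%R; first by rewrite fk0 gk0.
by move/(graph_val g f k (esym eq_fg)).
Qed.

(* Raising f at a coordinate below the one deciding f < g gives an element
   strictly between them. *)
Lemma unbounded_dense_zpow :
  inhabited K -> (forall k, exists l, l < k) -> unbounded_dense (zpow K).
Proof.
move=> [k0] K_lt.
have up f k : exists2 h : zpow K, f < h & forall l, l != k -> h l = f l.
  have [h [hk hE]] := zpow_update f k (f k + 1)%R; exists h => //.
  rewrite zpow_ltE; apply/zpow_ltP; exists k.
    by rewrite hk Num.Theory.ltrDl.
  by move=> l kl; rewrite hE // gt_eqF.
split=> [|f|f|f g].
- exact: zpow_inhabited.
- have [h [hk hE]] := zpow_update f k0 (f k0 - 1)%R; exists h.
  rewrite zpow_ltE; apply/zpow_ltP; exists k0.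
    by rewrite hk Num.Theory.ltrBlDr Num.Theory.ltrDl.
  by move=> l kl; rewrite hE // gt_eqF.
- by have [h fh _] := up f k0; exists h.
rewrite zpow_ltE => /zpow_ltP[k fgk fg].
have [l lk] := K_lt k; have [h fh hE] := up f l; exists h; rewrite fh /=.
rewrite zpow_ltE; apply/zpow_ltP; exists k; first by rewrite hE // gt_eqF.
by move=> m km; rewrite hE ?fg // gt_eqF // (lt_trans lk).
Qed.

End ZPowTheory.

(** * Restriction to suborders and gluing *)

Section SubOrder.
Context {d : Order.disp_t} {K : orderType d} (P : pred K).

Definition suborder : Type := {k : K | P k}.

HB.instance Definition _ := SubChoice.on suborder.
HB.instance Definition _ :=
  [SubChoice_isSubOrder of suborder by <: with d].

Lemma countable_suborder :
  countable [set: K]%classic -> countable [set: suborder]%classic.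
Proof. exact: countable_inj val_inj. Qed.

Lemma zpow_restriction :
  exists r : zpow K -> zpow suborder, forall f x, r f x = f (val x).
Proof.
suff /choice[r rE] (f : zpow K) :
    exists h : zpow suborder, forall x, h x = f (val x) by exists r.
apply: (@zpow_of_fun _ _ _ (pmap insub (zpow_supp f))) => x.
by rewrite mem_pmap_sub in_zpow_supp.
Qed.

End SubOrder.

(** This makes the pair of restrictions to [P] and its complement surjective. *)
Lemma zpow_glue {d} {K : orderType d} (P : pred K)
    (u : zpow (suborder P)) (v : zpow (suborder (predC P))) :
  exists h : zpow K,
    (forall x, h (val x) = u x) /\ (forall x, h (val x) = v x).
Proof.
pose F (k : K) : int :=
  if insub k is Some x then u x else if insub k is Some x then v x else 0%R.
have [k|h hE] := @zpow_of_fun _ _ F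
    (map val (zpow_supp u) ++ map val (zpow_supp v)).
  rewrite /F mem_cat; case: insubP => [x _ <- ux|_].
    by rewrite map_f ?in_zpow_supp.
  by case: insubP => [x _ <- vx|_]; rewrite ?eqxx // map_f ?in_zpow_supp ?orbT.
exists h; split=> x; rewrite hE /F; first by rewrite valK.
by rewrite insubN ?valK //; apply: (valP x).
Qed.

(** * The well-ordered part and its complement *)

Section WellOrderedPart.
Context {d : Order.disp_t} {K : orderType d}.

(* The k such that the elements below k are well-ordered: quantifying over the
   S containing k is equivalent, as only the part of S below k matters. *)
Definition well_ordered_part : pred K :=
  fun k => `[< forall S : {pred K}, k \in S -> exists m, minimum_of <=%O S m >].

Local Notation A := well_ordered_part.

Lemma well_ordered_part_initial (k l : K) : l < k -> A k -> A l.
Proof.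
move=> lk /asboolP Ak; apply/asboolP => S lS.
(* Adjoining [k] makes the assumption on [k] applicable; the minimum obtained is not [k], because
   [l < k] lies in [S]. *)
have [|m [+ mS]] := Ak [predU1 k & S]; first by rewrite !inE eqxx.
have mS' x : x \in S -> m <= x by move=> xS; apply: mS; rewrite !inE xS orbT.
rewrite !inE => /predU1P[mk|mS0]; last by exists m.
by have := mS' l lS; rewrite mk leNgt lk.
Qed.

Lemma well_order_well_ordered_part : well_order (<=%O : rel (suborder A)).
Proof.
apply: antisymmetric_well_order; first exact: le_anti.
move=> S [a aS].
(* [T] is the image of [S] in [K]; it contains [val a], a point of the well-ordered part, hence has
   a minimum. *)
pose T : {pred K} := [pred k | `[< exists2 x, x \in S & val x = k >]].
have Tval x : x \in S -> val x \in T.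
  by move=> xS; apply/asboolP; exists x.
have /asboolP/(_ T (Tval a aS))[m [mT leT]] := valP a.
have [x xS xm] := asboolP _ mT.
exists x; split=> // y yS.
by have := leT _ (Tval y yS); rewrite -xm.
Qed.

Lemma well_ordered_part_compl_no_min (x : suborder (predC A)) :
  exists y, y < x.
Proof.
(* A set [S] containing [x] and without minimum has an element [s] below [x], and the same [S] shows
   that [s] is outside the well-ordered part. *)
have /asboolPn/existsNP[S /not_implyP[xS /forallNP noMin]] := valP x.
have [s sS sx] : exists2 s, s \in S & s < val x.
  apply/not_exists2P => lex; apply: (noMin (val x)); split=> // s sS.
  by rewrite leNgt; apply/negP => sx; case: (lex s).
have As : ~~ A s.
  by apply/negP => /asboolP/(_ S sS)[m /noMin].
by exists (Sub s As : suborder (predC A)).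
Qed.

Lemma well_ordered_part_compl_nonempty :
  ~ well_order (<=%O : rel K) -> inhabited (suborder (predC A)).
Proof.
move=> nwo; apply: contrapT => B0; apply: nwo.
apply: antisymmetric_well_order; first exact: le_anti.
move=> S [k kS]; have Ak : A k.
  by apply: contrapT => /negP NAk; apply: B0; constructor; exists k.
by have /asboolP/(_ S kS) := Ak.
Qed.

End WellOrderedPart.

Arguments well_ordered_part {d} K.

(** * Splitting the power along an initial segment, and the conclusion *)

Lemma zpow_split_homo {d} {K : orderType d} (P : pred K)
    (rA : zpow K -> zpow (suborder P))
    (rB : zpow K -> zpow (suborder (predC P))) :
  (forall k l, l < k -> P k -> P l) ->
  (forall f x, rA f x = f (val x)) -> (forall f x, rB f x = f (val x)) ->
  forall f g : zpow K,
    f < g -> rB f < rB g \/ rB f = rB g /\ rA f < rA g.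
Proof.
move=> P_initial rAE rBE f g; rewrite zpow_ltE => /zpow_ltP[k fgk fg].
(* Here [k] is the largest coordinate where [f] and [g] differ. If it lies in the initial segment
   [P], the whole complement is above it, so the restrictions there agree; otherwise it decides the
   comparison on the complement. *)
have [Pk|NPk] := boolP (P k); [right; split|left].
- apply/zpow_eqP => x; rewrite !rBE fg //; have := valP x.
  rewrite ltNge; apply: contra; rewrite le_eqVlt.
  by move=> /predU1P[->//|/P_initial]; apply.
- rewrite zpow_ltE; apply/zpow_ltP; exists (Sub k Pk).
    by rewrite !rAE SubK.
  by move=> x kx; rewrite !rAE fg.
- rewrite zpow_ltE; apply/zpow_ltP; exists (Sub k NPk).
    by rewrite !rBE SubK.
  by move=> x kx; rewrite !rBE fg.
Qed.

Theorem proposition3p9 (d : Order.disp_t) (K : orderType d)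
    (K_countable : countable [set: K]%classic)
    (K_not_wo : ~ well_order (<=%O : rel K)) :
  (exists (d' : Order.disp_t) (A : orderType d'),
     [/\ countable [set: A]%classic,
         well_order (<=%O : rel A)
       & order_iso (zpow K) (order_prod (zpow A) rat)])
  /\ epi_equiv (zpow K) rat.
Proof.
pose P := well_ordered_part K.
have B_nonempty := well_ordered_part_compl_nonempty K_not_wo.
have ZB_dense : unbounded_dense (zpow (suborder (predC P))).
  exact: unbounded_dense_zpow B_nonempty well_ordered_part_compl_no_min.
have [c c_homo c_surj] := cantor_order_iso
  (countable_zpow (countable_suborder (predC P) K_countable))
  (countableP [set: rat]%classic) ZB_dense unbounded_dense_rat.
have [rA rAE] := zpow_restriction P.
have [rB rBE] := zpow_restriction (predC P).
have r_homo := zpow_split_homo P rA rB well_ordered_part_initial rAE rBE.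
have r_surj u v : exists f, rA f = u /\ rB f = v.
  have [h [hu hv]] := zpow_glue P u v.
  by exists h; split; apply/zpow_eqP => x; rewrite ?rAE ?rBE ?hu ?hv.
split; last split.
- exists d, (suborder P); split.
  + exact: countable_suborder.
  + exact: well_order_well_ordered_part.
  (* The restriction to the complement, carried to the rationals by [c], is the dominant
     coordinate. *)
  apply: (@strict_mono_surj_order_iso _ _ _ (order_prod (zpow (suborder P)) rat)
    (fun f => (c (rB f), rA f))) => [f g /r_homo|[q u]].
    by rewrite lexi_ltE /= => -[/c_homo -> //|[-> ->]]; rewrite eqxx orbT.
  have [v cv] := c_surj q; have [f [fu fv]] := r_surj u v.
  by exists f; rewrite fu fv cv.
(* The order with a copy of the rationals at each point of [zpow K] is countable, dense and
   unbounded; following [e] by the first projection gives the epimorphism onto [zpow K]. *)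
- have [e e_homo e_surj] := @cantor_order_iso _ _ rat (order_prod rat (zpow K))
    (countableP [set: rat]%classic)
    (countable_prod (countable_zpow K_countable) (countableP [set: rat]%classic))
    unbounded_dense_rat (unbounded_dense_lexi zpow_inhabited unbounded_dense_rat).
  apply: (epi_leI (fun q => (e q).1)) => [q r|f].
    by rewrite -(le_mono e_homo) leEprodlexi => /andP[].
  by have [q eq] := e_surj (f, 0%R); exists q; rewrite eq.
- apply: (epi_leI (fun f => c (rB f))) => [f g|q].
    rewrite le_eqVlt => /predU1P[->//|/r_homo[/c_homo/ltW//|[-> _]]].
    exact: lexx.
  have [v cv] := c_surj q.
  (* Any [u] serves as the part on [P], since the map forgets it. *)
  have [u] := @zpow_inhabited _ (suborder P).
  by have [f [_ fv]] := r_surj u v; exists f; rewrite fv.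
Qed.
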